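(* Let $M$ be a finite metric space, and let $n=\#M$. Let $d$ be an arbitrary real number with $d>\operatorname{mf}(M)$ (for example, any $d>(n-1)\operatorname{diam}M$), and let $\lambda$ be an arbitrary real number with $\lambda\ge 2d$. Then $$ \operatorname{mf}(M)=\inf\biggl\{\sum_{k=1}^\infty\bigl[\lambda-2\,d_{GH}(V,\lambda\Delta_{k+1})\bigr]:V\in\mathcal{M}(M,d)\biggr\}. $$
   Context: For a metric space, $|xy|$ denotes the distance between points $x$ and $y$, and $\#M$ is the cardinality of $M$. $d_{GH}$ denotes the Gromov--Hausdorff distance: $d_{GH}(X,Y)$ is the infimum of real numbers $r$ such that there exist a metric space $Z$ and subsets $X',Y'\subset Z$ isometric to $X$ and $Y$ respectively with Hausdorff distance $d_H(X',Y')\le r$. For $\lambda>0$, $\lambda\Delta_m$ denotes the metric space on $\{1,\ldots,m\}$ all of whose nonzero distances equal $\lambda$. Steiner minimal tree length: a graph $G=(V,E)$ is defined on a metric space $X$ if $V\subset X$; the length of an edge $vw$ is $|vw|$ and the length $|G|$ of $G$ is the sum of the lengths of its edges. For a nonempty finite $M\subset X$, a connected graph $G=(V,E)$ on $X$ joins $M$ if $M\subset V$. The number $\operatorname{smt}(M,X)$ is the infimum of the lengths of the connected graphs on $X$ that join $M$. Minimal filling length: for a finite metric space $M$, $\operatorname{mf}(M)$ is the infimum of the real numbers $r$ such that there exist a metric space $X$ and an isometric (distance-preserving) embedding $\mu\colon M\to X$ with $\operatorname{smt}(\mu(M),X)\le r$. For an $n$-point metric space $M$ and a real number $d$, $\mathcal{M}(M,d)$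 is the family of (isometry classes of) metric spaces $V$ that contain $M$ as a metric subspace ($M\subset V$ with the metric of $V$ restricting to that of $M$) and satisfy $\#V\le 2n-2$ and $\operatorname{diam}V\le d$.
   Formalization: The formal theorem assumes n ≥ 2: for a one-point M the bound #V ≤ 2n−2 = 0 makes the family M(M,d) empty, so the right-hand infimum is +∞ while mf(M) = 0; for n = 0 smt is not defined. *)

(* Defs.v *)
From HB Require Import structures.
From mathcomp Require Import all_boot all_order all_algebra.
From mathcomp Require Import all_classical all_reals all_analysis.

Set Implicit Arguments.
Unset Strict Implicit.
Unset Printing Implicit Defensive.

Import Order.TTheory GRing.Theory Num.Theory.

Local Open Scope classical_set_scope.
Local Open Scope card_scope.
Local Open Scope ring_scope.
Local Open Scope ereal_scope.

Definition distance_preserving (R : realType) (X Y : metricType R)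
    (f : X -> Y) : Prop :=
  forall x y : X, mdist (f x) (f y) = mdist x y.

Definition diameter (R : realType) (X : metricType R) : \bar R :=
  ereal_sup [set (mdist p.1 p.2)%:E | p in [set: X * X]].

Definition hausdorff_distance (R : realType) (Z : metricType R)
    (A B : set Z) : \bar R :=
  maxe
    (ereal_sup [set ereal_inf [set (mdist a b)%:E | b in B] | a in A])
    (ereal_sup [set ereal_inf [set (mdist a b)%:E | a in A] | b in B]).

(* The subsets of Z isometric to X are the images of X under the              *)
(* distance-preserving maps X -> Z.                                           *)
Definition gromov_hausdorff (R : realType) (X Y : metricType R) : \bar R :=
  ereal_inf [set r%:E | r in [set r : R |
    exists (Z : metricType R) (f : X -> Z) (g : Y -> Z),
      [/\ distance_preserving f, distance_preserving g &
          hausdorff_distance (range f) (range g) <= r%:E]]].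

(* The space lambda Delta_m, on {0, .., m-1} instead of {1, .., m}.           *)
Definition simplex (R : realType) (lambda : R)
  (lambda_gt0 : (0 < lambda)%R) (m : nat) : Type := 'I_m.

Section SimplexMetric.
Context {R : realType} (lambda : R) (lambda_gt0 : (0 < lambda)%R) (m : nat).

Let T : Type := simplex lambda_gt0 m.

HB.instance Definition _ := Choice.copy T 'I_m.

Definition simplex_dist (i j : T) : R := if i == j then 0%R else lambda.

Let distxx (i : T) : simplex_dist i i = 0%R.
Proof. by rewrite /simplex_dist eqxx. Qed.

Let dist_positivity (i j : T) : simplex_dist i j = 0%R -> i = j.
Proof.
rewrite /simplex_dist; case: eqP => // _ l0.
by move: lambda_gt0; rewrite l0 ltxx.
Qed.

Let dist_sym (i j : T) : simplex_dist i j = simplex_dist j i.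
Proof. by rewrite /simplex_dist eq_sym. Qed.

Let dist_triangle (j i k : T) :
  (simplex_dist i k <= simplex_dist i j + simplex_dist j k)%R.
Proof.
have l0 := ltW lambda_gt0; rewrite /simplex_dist.
case: (eqVneq i j) => [->|_]; first by rewrite add0r.
by case: (j == k); case: (i == k); rewrite ?addr0 ?addr_ge0 ?lerDl.
Qed.

HB.instance Definition _ :=
  isMetric.Build R T distxx dist_positivity dist_sym dist_triangle.

End SimplexMetric.

(* Simple graphs whose vertices are points of X; they need not be finite.     *)
Record graph (R : realType) (X : metricType R) := Graph {
  vertices : set X ;
  adjacent : rel X ;
  adjacent_sym : symmetric adjacent ;
  adjacent_irr : irreflexive adjacent ;
  adjacent_vertices : forall v w : X, adjacent v w -> vertices v
}.

(* Each edge {v, w} is counted twice in the sum, as (v, w) and as (w, v).     *)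
Definition graph_length (R : realType) (X : metricType R) (G : graph X) :
    \bar R :=
  (2^-1)%:E *
  \esum_(p in [set p : X * X | adjacent G p.1 p.2]) (mdist p.1 p.2)%:E.

Definition connected_graph (R : realType) (X : metricType R) (G : graph X) :
    Prop :=
  forall v w : X, vertices G v -> vertices G w ->
    exists2 s : seq X, path (adjacent G) v s & last v s = w.

Definition smt (R : realType) (X : metricType R) (M : set X) : \bar R :=
  ereal_inf [set graph_length G | G in
    [set G : graph X | connected_graph G /\ M `<=` vertices G]].

Definition mf (R : realType) (M : metricType R) : \bar R :=
  ereal_inf [set r%:E | r in [set r : R |
    exists (X : metricType R) (mu : M -> X),
      distance_preserving mu /\ smt (range mu) <= r%:E]].

(* The family M(M, d) for an n-point space M; the inclusion of M in V is an   *)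
(* arbitrary distance-preserving map.                                         *)
Definition in_family (R : realType) (M : metricType R) (n : nat) (d : R)
    (V : metricType R) : Prop :=
  [/\ exists i : M -> V, distance_preserving i,
      [set: V] #<= `I_(2 * n - 2) &
      diameter V <= d%:E].

Lemma graph_length_ge0 (R : realType) (X : metricType R) (G : graph X) :
  0 <= graph_length G.
Proof.
apply: mule_ge0; first by rewrite lee_fin invr_ge0.
by apply: esum_ge0 => p _; rewrite lee_fin mdist_ge0.
Qed.

Lemma smt_ge0 (R : realType) (X : metricType R) (M : set X) : 0 <= smt M.
Proof. by apply: le_ereal_inf_tmp => _ [G _ <-]; exact: graph_length_ge0. Qed.

Lemma mf_ge0 (R : realType) (M : metricType R) : 0 <= mf M.
Proof.
apply: le_ereal_inf_tmp => _ [r [X [mu [_ smtr]]] <-].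
exact: le_trans (smt_ge0 _) smtr.
Qed.

Lemma scale_gt0 (R : realType) (M : metricType R) (d lambda : R) :
  mf M < d%:E -> (2 * d <= lambda)%R -> (0 < lambda)%R.
Proof.
move=> mfd; apply: lt_le_trans; rewrite mulr_gt0//.
by rewrite -lte_fin; exact: le_lt_trans (mf_ge0 M) mfd.
Qed.

(* Main.v *)
Require Import Defs.
From HB Require Import structures.
From mathcomp Require Import all_boot all_order all_algebra.
From mathcomp Require Import all_classical all_reals all_analysis.
From mathcomp Require Import lra zify.

Set Implicit Arguments.
Unset Strict Implicit.
Unset Printing Implicit Defensive.

Import Order.TTheory GRing.Theory Num.Theory.

Local Open Scope classical_set_scope.
Local Open Scope card_scope.
Local Open Scope ring_scope.
Local Open Scope ereal_scope.

(* When lambda >= 2 diam V, the number lambda - 2 d_GH(V, lambda Delta_{k+1}) *)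
(* is the largest alpha such that V splits into k + 1 nonempty classes at     *)
(* mutual distance at least alpha (and 0 if V has at most k points).  By      *)
(* Kruskal's algorithm the sum of these numbers is the length of a minimum    *)
(* spanning tree of V: joining the closest pair of classes repeatedly         *)
(* produces edges bounded by the terms of the sum, and conversely any         *)
(* connecting list of edges has at least k edges between the k + 1 classes,   *)
(* so its k-th longest edge bounds the k-th term.                             *)
(* A spanning tree of V in the family joins M, which bounds mf(M) from above. *)
(* Conversely a graph joining M in some X contains a finite tree through M;   *)
(* removing vertices of degree at most two outside M leaves at most 2n - 2    *)
(* vertices by a degree count, and these vertices with the metric of X form a *)
(* member of the family.                                                      *)

(** Both inequalities pass through the minimum spanning tree of V. The lemmas
    [gromov_hausdorff_simplex_le] and [le_gromov_hausdorff_simplex] translate a term of the series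
    into separations of partitions of V. From this, [exists_spanning_edges] finds a connecting edge
    list no longer than the series, and [series_le_total_length] shows that no connecting edge list
    is shorter than it. With [mf_le_total_length], every V in the family then gives a filling of M
    no longer than its series. Conversely, a graph joining M of length below d contains a finite
    tree ([grow_to_cover]), which shrinks to at most 2n - 2 vertices ([steiner_reduction]) and
    becomes a space of its own ([subspace_of_tree]). Its diameter is below d because points of a
    tree are no further apart than its length. *)

(* Connectivity of an edge list through cuts: every two-colouring that is     *)
(* constant along the edges is constant on W.                                 *)
Definition connects (T : eqType) (E : seq (T * T)) (W : set T) : Prop :=
  forall q : T -> bool, {in E, forall e, q e.1 = q e.2} ->
    forall x y, W x -> W y -> q x = q y.

Definition total_length (R : realType) (X : metricType R) (E : seq (X * X)) :
    R := (\sum_(e <- E) mdist e.1 e.2)%R.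

Lemma total_length_cons (R : realType) (X : metricType R) (e : X * X)
    (E : seq (X * X)) :
  total_length (e :: E) = (mdist e.1 e.2 + total_length E)%R.
Proof. by rewrite /total_length big_cons. Qed.

Lemma total_length_ge0 (R : realType) (X : metricType R) (E : seq (X * X)) :
  (0 <= total_length E)%R.
Proof. by apply: sumr_ge0 => e _; exact: mdist_ge0. Qed.

(** * Edges crossing a partition *)

Lemma connects_const (T J : eqType) (E : seq (T * T)) (W : set T)
    (q : T -> J) :
  connects E W -> {in E, forall e, q e.1 = q e.2} ->
  forall x y, W x -> W y -> q x = q y.
Proof.
move=> cE qE x y Wx Wy.
have := cE (fun z => q z == q y) _ x y Wx Wy.
by rewrite eqxx => qxy; apply/eqP/qxy => e /qE ->.
Qed.

(** Identifying the ends of one more edge merges at most two values of [r], so each edge costs at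
    most one element of the image. *)
Lemma identify_edges (J : finType) (F : seq (J * J)) :
  exists2 r : J -> J, {in F, forall e, r e.1 = r e.2} &
    (#|J| <= #|[set r x | x : J]%SET| + size F)%N.
Proof.
elim: F => [|e F [r rF leJ]] /=.
  by exists id => //; rewrite (card_imset _ (@inj_id J)) addn0.
pose r' x := if r x == r e.1 then r e.2 else r x; exists r'.
  move=> f; rewrite inE => /predU1P[->|/rF]; last by rewrite /r' => ->.
  by rewrite /r' eqxx; case: eqP.
apply: leq_trans leJ _; rewrite addnS -addSn leq_add2r.
suff /subset_leq_card : [set r x | x : J]%SET \subset (r e.1 |: [set r' x | x : J])%SET.
  by move=> /leq_trans; apply; rewrite cardsU1 -[leqRHS]add1n leq_add2r leq_b1.
apply/fintype.subsetP => _ /imsetP[x _ ->]; rewrite !inE.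
case: eqP => //= /eqP rx; apply/imsetP; exists x => //.
by rewrite /r' (negPf rx).
Qed.

(** Contract each class of [p] to a point. Identifying ends of crossing edges collapses J to a
    single point by connectivity, while each crossing edge removes at most one point. *)
Lemma card_le_crossing (T : eqType) (J : finType) (E : seq (T * T))
    (p : T -> J) :
  connects E [set: T] -> (forall j, exists x, p x = j) ->
  (#|J| <= (count (fun e => p e.1 != p e.2) E).+1)%N.
Proof.
move=> cE p_surj.
have [r rF] := identify_edges
  [seq (p e.1, p e.2) | e <- E & p e.1 != p e.2].
rewrite size_map size_filter => /leq_trans; apply; rewrite -addn1 addnC leq_add2l.
have [[j0]|J0] := pselect (inhabited J); last first.
  rewrite leqNgt; apply/negP => /ltnW/card_gt0P[_ /imsetP[j _ _]].
  exact: J0 (inhabits j).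
suff /subset_leq_card : [set r x | x : J]%SET \subset [set r j0]%SET.
  by rewrite cards1.
apply/fintype.subsetP => _ /imsetP[j _ ->]; rewrite inE.
have [[x <-] [y <-]] := (p_surj j, p_surj j0); apply/eqP.
apply: (connects_const (q := r \o p) cE) => // e eE /=.
have [->//|ne] := eqVneq (p e.1) (p e.2).
by apply: (rF (p e.1, p e.2)); apply/mapP; exists e => //; rewrite mem_filter ne.
Qed.

Lemma count_gt_nth (R : realType) (s : seq R) (k : nat) :
  sorted >=%R s -> (count (fun x => nth 0%R s k < x)%R s <= k)%N.
Proof.
move=> s_sorted; have [ks|ks] := leqP (size s) k.
  exact: leq_trans (count_size _ _) ks.
rewrite -{2}(cat_take_drop k s) count_cat.
rewrite [X in (_ + X)%N](_ : _ = 0%N) ?addn0.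
  by rewrite (leq_trans (count_size _ _))// size_take ks.
apply/eqP; rewrite -leqn0 leqNgt -has_count; apply/hasPn => x /(nthP 0%R)[i].
rewrite size_drop nth_drop ltn_subRL => iks <-; rewrite -leNgt.
by apply: (sorted_leq_nth (@ge_trans _ R) (@ge_refl _ R)) => //; rewrite ?inE// leq_addr.
Qed.

(** * Distance to a simplex *)

(** A copy of [T] whose type mentions the metric axioms, so that an instance can be attached to a
    distance constructed inside a proof. *)
Definition metrized (R : realType) (T : choiceType) (d : T -> T -> R)
  (dxx : forall x, d x x = 0%R) (d_eq0 : forall x y, d x y = 0%R -> x = y)
  (dC : forall x y, d x y = d y x)
  (d_tri : forall y x z, (d x z <= d x y + d y z)%R) : Type := T.

Section Metrized.
Context {R : realType} {T : choiceType} {d : T -> T -> R}.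
Context (dxx : forall x, d x x = 0%R) (d_eq0 : forall x y, d x y = 0%R -> x = y).
Context (dC : forall x y, d x y = d y x).
Context (d_tri : forall y x z, (d x z <= d x y + d y z)%R).

Let Z : Type := metrized dxx d_eq0 dC d_tri.

HB.instance Definition _ := Choice.copy Z T.
HB.instance Definition _ := isMetric.Build R Z dxx d_eq0 dC d_tri.

End Metrized.

Lemma metric_space_of (R : realType) (T : choiceType) (d : T -> T -> R) :
  (forall x, d x x = 0%R) -> (forall x y, d x y = 0%R -> x = y) ->
  (forall x y, d x y = d y x) ->
  (forall y x z, d x z <= d x y + d y z)%R ->
  exists (Z : metricType R) (e : T -> Z),
    bijective e /\ forall x y, mdist (e x) (e y) = d x y.
Proof.
move=> dxx d_eq0 dC d_tri.
by exists (metrized dxx d_eq0 dC d_tri), id; split => //; exists id.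
Qed.

Lemma hausdorff_distance_le (R : realType) (Z : metricType R) (A B : set Z)
    (r : R) :
  (forall a, A a -> exists2 b, B b & mdist a b <= r)%R ->
  (forall b, B b -> exists2 a, A a & mdist a b <= r)%R ->
  hausdorff_distance A B <= r%:E.
Proof.
move=> AB BA; rewrite /hausdorff_distance ge_max; apply/andP; split.
- apply: ge_ereal_sup => _ [a /AB[b Bb abr] <-].
  by apply: le_trans (_ : (mdist a b)%:E <= _); [apply: ereal_inf_lbound; exists b|].
- apply: ge_ereal_sup => _ [b /BA[a Aa abr] <-].
  by apply: le_trans (_ : (mdist a b)%:E <= _); [apply: ereal_inf_lbound; exists a|].
Qed.

Lemma hausdorff_distance_lt (R : realType) (Z : metricType R) (A B : set Z)
    (r : R) :
  hausdorff_distance A B < r%:E ->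
  (forall a, A a -> exists2 b, B b & mdist a b < r)%R /\
  (forall b, B b -> exists2 a, A a & mdist a b < r)%R.
Proof.
rewrite /hausdorff_distance gt_max => /andP[AB BA]; split => [a Aa|b Bb].
- have /ereal_inf_lt[_ [b Bb <-]] :
      ereal_inf [set (mdist a b)%:E | b in B] < r%:E.
    by apply: le_lt_trans AB; apply: ereal_sup_ubound; exists a.
  by rewrite lte_fin => abr; exists b.
- have /ereal_inf_lt[_ [a Aa <-]] :
      ereal_inf [set (mdist a b)%:E | a in A] < r%:E.
    by apply: le_lt_trans BA; apply: ereal_sup_ubound; exists b.
  by rewrite lte_fin => abr; exists a.
Qed.

Section SimplexGromovHausdorff.
Variables (R : realType) (V : metricType R) (lambda : R).
Variables (lambda_gt0 : (0 < lambda)%R) (m : nat).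

Let D : metricType R := simplex lambda_gt0 m.

Let mdistD (i j : D) : mdist i j = (if i == j then 0 else lambda)%R.
Proof. by []. Qed.

(* Points are glued to their class at distance (lambda - alpha) / 2 and to    *)
(* the other vertices at distance (lambda + alpha) / 2; alpha = 0 makes the   *)
(* map p irrelevant, which covers simplices with more vertices than V.        *)
Lemma gromov_hausdorff_simplex_le (p : V -> D) (alpha : R) :
  (0 <= alpha < lambda)%R -> (forall v w : V, mdist v w <= lambda - alpha)%R ->
  (forall v w : V, p v != p w -> alpha <= mdist v w)%R ->
  (forall j, exists v, alpha = 0%R \/ p v = j) ->
  gromov_hausdorff V D <= ((lambda - alpha) / 2)%:E.
Proof.
move=> /andP[alpha_ge0 alpha_lt] diamV sep_p p_surj.
pose c (v : V) (j : D) : R :=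
  (if p v == j then (lambda - alpha) / 2 else (lambda + alpha) / 2)%R.
pose dist (x y : V + D) : R :=
  match x, y with
  | inl v, inl w => mdist v w
  | inl v, inr j => c v j
  | inr j, inl v => c v j
  | inr i, inr j => mdist i j
  end.
have c_gt0 v j : (0 < c v j)%R by rewrite /c; case: ifP => _; lra.
have [||||Z [e [_ eE]]] := @metric_space_of R _ dist.
- by case=> x /=; rewrite mdistxx.
- case=> x [] y //= => [/mdist_positivity->//|cxy|cxy|/mdist_positivity->//].
  + by move: (c_gt0 x y); rewrite cxy ltxx.
  + by move: (c_gt0 y x); rewrite cxy ltxx.
- by case=> x [] y //=; rewrite metric_sym.
(* [tri1] uses the separation of the classes, [tri2] the diameter bound (two points of one class are
   joined through its vertex at cost lambda - alpha), and [tri3] that v lies in only one class. *)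
- have tri1 (v w : V) (j : D) : (c v j <= mdist v w + c w j)%R.
    rewrite /c; have := mdist_ge0 v w.
    case: (eqVneq (p v) j) => [_|vj]; case: (eqVneq (p w) j) => [wj|_]; try lra.
    by have := @sep_p v w; rewrite wj => /(_ vj); lra.
  have tri2 (v w : V) (j : D) : (mdist v w <= c v j + c w j)%R.
    have := diamV v w; rewrite /c.
    by case: (p v == j); case: (p w == j); lra.
  have tri3 (v : V) (i j : D) : (mdist i j <= c v i + c v j)%R.
    rewrite mdistD /c; case: (eqVneq i j) => [_|ij]; first by case: ifP; case: ifP; lra.
    case: (eqVneq (p v) i) => [->|_]; first by rewrite (negPf ij); lra.
    by case: ifP; lra.
  have tri4 (v : V) (i j : D) : (c v i <= mdist i j + c v j)%R.
    rewrite mdistD /c; case: (eqVneq i j) => [->|ij]; first by rewrite add0r.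
    by case: ifP; case: ifP; lra.
  case=> y [] x [] z /=; rewrite ?metric_triangle//.
  + by rewrite addrC metric_sym tri1.
  + by rewrite addrC metric_sym tri4.
apply: ereal_inf_lbound; exists ((lambda - alpha) / 2)%R => //=.
exists Z, (e \o inl), (e \o inr); split => [v w|i j|]; rewrite ?eE//.
apply: hausdorff_distance_le => _ [x _ <-].
- exists (e (inr (p x))); first by exists (p x).
  by rewrite /= eE /= /c eqxx.
- have [v vx] := p_surj x; exists (e (inl v)); first by exists v.
  rewrite /= eE /= /c; case: vx => [->|->]; last by rewrite eqxx.
  by case: ifP => _; lra.
Qed.

(** In a common space at Hausdorff distance below s, sending each point to a vertex closer than s
    gives a partition. When 2s < lambda - beta, every vertex is hit and distinct classes are more
    than beta apart. If V has fewer than m points, the hypothesis is vacuous. *)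
Lemma le_gromov_hausdorff_simplex (beta : R) :
  (0 <= beta)%R ->
  (forall p : V -> 'I_m, (forall j, exists v, p v = j) ->
    exists v w, p v != p w /\ (mdist v w <= beta)%R) ->
  ((lambda - beta) / 2)%:E <= gromov_hausdorff V D.
Proof.
move=> beta_ge0 Hbeta; apply: le_ereal_inf_tmp => _ [r [Z [f [g [fE gE fgr]]]] <-].
rewrite lee_fin leNgt; apply/negP => r_lt.
(* The midpoint turns the bound by r into a strict one, so that actual nearby points exist. *)
pose s := ((r + (lambda - beta) / 2) / 2)%R.
have rs : (r < s)%R by rewrite /s; lra.
have sl : (2 * s < lambda - beta)%R by rewrite /s; lra.
have [fg gf] := hausdorff_distance_lt (le_lt_trans fgr (rs : r%:E < s%:E)).
have /choice[p pE] : forall v, exists j : D, (mdist (f v) (g j) < s)%R.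
  by move=> v; have [|_ [j _ <-]] := fg (f v); [exists v|exists j].
have p_surj (j : 'I_m) : exists v, p v = j.
  have [|_ [v _ <-] vj] := gf (g j); first by exists j.
  exists v; apply/eqP/negPn/negP => ne.
  have := metric_triangle (g (p v)) (f v) (g j).
  rewrite gE mdistD (negPf ne) metric_sym; have := pE v; lra.
have [v [w [ne vw]]] := Hbeta p p_surj.
have := metric_triangle (g (p v)) (f v) (g (p w)).
have := metric_triangle (f v) (f w) (g (p w)).
rewrite gE fE mdistD (negPf ne) (metric_sym (g (p v))).
have := pE v; have := pE w; lra.
Qed.

End SimplexGromovHausdorff.

(** * Spanning trees *)

Lemma seq_argmin (R : realType) (T : eqType) (f : T -> R) (s : seq T) (x0 : T) :
  x0 \in s -> exists2 x, x \in s & {in s, forall y, f x <= f y}%R.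
Proof.
elim: s x0 => // a s IHs x0 _.
have [->|[b bs]] : s = [::] \/ exists b, b \in s.
  by case: (s) => [|b s']; [left|right; exists b; rewrite mem_head].
  by exists a; rewrite ?mem_head// => y; rewrite inE => /eqP ->.
have [x xs xmin] := IHs b bs; have [ax|xa] := leP (f a) (f x).
  exists a; rewrite ?mem_head// => y; rewrite inE => /predU1P[->//|/xmin].
  exact: le_trans.
exists x; first by rewrite inE xs orbT.
by move=> y; rewrite inE => /predU1P[->|/xmin//]; exact: ltW.
Qed.

Lemma sum_nth_le (R : realType) (s : seq R) (m : nat) :
  all (>= 0)%R s -> (\sum_(0 <= i < m) nth 0 s i <= \sum_(x <- s) x)%R.
Proof.
elim: s m => [|a s IHs] m /=.
  by rewrite big_nil big1// => i _; rewrite nth_nil.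
move=> /andP[a0 s0]; case: m => [|m].
  rewrite big_nil big_cons addr_ge0//.
  by rewrite big_seq sumr_ge0// => x /(allP s0).
by rewrite big_nat_recl//= big_cons lerD2l IHs.
Qed.

Section SpanningTree.
Variables (R : realType) (V : metricType R) (s : seq V) (v0 : V).
Variables (d lambda : R) (lambda_gt0 : (0 < lambda)%R).
Hypothesis s_enum : forall v, v \in s.
Hypothesis diamV : forall v w : V, (mdist v w <= d)%R.
Hypothesis le_2d_lambda : (2 * d <= lambda)%R.

Let term (k : nat) : \bar R :=
  lambda%:E - 2%:E * gromov_hausdorff V (simplex lambda_gt0 k.+1).

Let d_ge0 : (0 <= d)%R.
Proof. by have := diamV v0 v0; rewrite mdistxx. Qed.

Let term_ge (k : nat) (alpha : R) :
  gromov_hausdorff V (simplex lambda_gt0 k.+1) <= ((lambda - alpha) / 2)%:E ->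
  alpha%:E <= term k.
Proof.
move=> /(@lee_wpmul2l _ 2%:E) => /(_ _)/wrap[]; first by rewrite lee_fin.
rewrite -EFinM => ghle; apply: le_trans (leeB (lexx lambda%:E) ghle).
by rewrite -EFinB lee_fin; lra.
Qed.

Let term_ge0 (k : nat) : 0 <= term k.
Proof.
apply: (@term_ge k 0%R); apply: (@gromov_hausdorff_simplex_le _ _ _ _ _ (fun=> ord0)).
- by rewrite lexx lambda_gt0.
- by move=> v w; move: (diamV v w) d_ge0 le_2d_lambda; rewrite subr0; lra.
- by move=> v w; rewrite eqxx.
- by move=> j; exists v0; left.
Qed.

Let term_ge_sep (k : nat) (p : V -> 'I_k.+1) (v w : V) :
  (forall j, exists x, p x = j) ->
  (forall x y, p x != p y -> mdist v w <= mdist x y)%R ->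
  (mdist v w)%:E <= term k.
Proof.
move=> p_surj vw_min; apply/term_ge/(@gromov_hausdorff_simplex_le _ _ _ _ _ p).
- rewrite mdist_ge0/=; have := diamV v w; move: d_ge0 lambda_gt0 le_2d_lambda; lra.
- by move=> x y; move: (diamV v w) (diamV x y) le_2d_lambda; lra.
- exact: vw_min.
- by move=> j; have [x px] := p_surj j; exists x; right.
Qed.

Let term_le (k : nat) (beta : R) :
  ((lambda - beta) / 2)%:E <= gromov_hausdorff V (simplex lambda_gt0 k.+1) ->
  term k <= beta%:E.
Proof.
move=> /(@lee_wpmul2l _ 2%:E) => /(_ _)/wrap[]; first by rewrite lee_fin.
rewrite -EFinM => ghle; apply: le_trans (leeB (lexx lambda%:E) ghle) _.
by rewrite -EFinB lee_fin; lra.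
Qed.

(* Kruskal: the closest pair of points from distinct classes joins two of the *)
(* k + 2 classes, and its length is at most the term of index k + 1.          *)
Let joining_edges (k : nat) (p : V -> 'I_k.+1) :
  (forall j, exists x, p x = j) ->
  exists2 E : seq (V * V),
    forall q : V -> bool, (forall x y, p x = p y -> q x = q y) ->
      {in E, forall e, q e.1 = q e.2} -> forall x y, q x = q y &
    (total_length E)%:E <= \sum_(1 <= i < k.+1) term i.
Proof.
elim: k p => [|k IHk] p p_surj.
  exists [::]; last by rewrite big_geq// /total_length big_nil.
  by move=> q qp _ x y; apply: qp; rewrite !ord1.
have [x0 px0] := p_surj ord0; have [y0 py0] := p_surj ord_max.
pose pairs := [seq e <- [seq (x, y) | x <- s, y <- s] | p e.1 != p e.2].
have mem_pairs x y : ((x, y) \in pairs) = (p x != p y).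
  by rewrite mem_filter/= allpairs_f ?andbT.
have := seq_argmin (fun e => mdist e.1 e.2) (_ : (x0, y0) \in pairs).
rewrite mem_pairs px0 py0 => /(_ isT)[[v w]].
rewrite mem_pairs => vw vw_min.
(* The class of [w] is merged into that of [v]: [g] drops the label [p w] and gives its points the
   label [a'] of [v]. *)
have [a' pva] : exists a', p v = lift (p w) a'.
  by case: (unliftP (p w) (p v)) vw => [a' ->|->]; [exists a'|rewrite eqxx].
pose g j := odflt a' (unlift (p w) j).
have [|E Econn Elen] := IHk (g \o p).
  move=> j; have [x px] := p_surj (lift (p w) j).
  by exists x; rewrite /= /g px liftK.
exists ((v, w) :: E); last first.
  rewrite total_length_cons/= big_nat_recr//= addeC EFinD leeD//.
  apply: (term_ge_sep p_surj) => x y.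
  by rewrite -mem_pairs => /vw_min.
move=> q qp qE; have qvw : q v = q w by apply: (qE (v, w)); rewrite mem_head.
apply: Econn; last by move=> e eE; apply: qE; rewrite inE eE orbT.
(* Points of the class of [w] are traded for [v], which has the same colour; so [q] is constant on
   the merged classes. *)
have away x : exists x' j, [/\ q x = q x', p x' = lift (p w) j & g (p x) = j].
  case: (unliftP (p w) (p x)) => [j pxj|pxw].
    by exists x, j; rewrite /g pxj liftK.
  by exists v, a'; rewrite /g pxw unlift_none/= qvw; split => //; apply: qp.
move=> x y /=; have [x' [j [-> px' ->]]] := away x.
have [y' [j' [-> py' ->]]] := away y => jj'.
by apply: qp; rewrite px' py' jj'.
Qed.

Lemma exists_spanning_edges : exists2 E : seq (V * V),
  connects E [set: V] & (total_length E)%:E <= \sum_(1 <= k <oo) term k.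
Proof.
pose t := undup s; have t_enum v : v \in t by rewrite mem_undup.
have t_gt0 : (0 < size t)%N by rewrite -has_predT; apply/hasP; exists v0.
(* Kruskal's algorithm starts from the partition into singletons. *)
pose p v : 'I_(size t).-1.+1 := inord (index v t).
have pE v : p v = index v t :> nat.
  by rewrite /p inordK// prednK// index_mem.
have [|E Econn Elen] := @joining_edges _ p.
  move=> j; have jt : (j < size t)%N by rewrite -[ltnRHS]prednK.
  by exists (nth v0 t j); apply: val_inj; rewrite /= pE index_uniq// undup_uniq.
exists E.
  move=> q qE x y _ _; apply: Econn => // {}x {}y /(congr1 val)/=.
  by rewrite !pE => /(congr1 (nth v0 t)); rewrite !nth_index// => ->.
by apply: le_trans Elen _; apply: nneseries_lim_ge => k _ _; exact: term_ge0.
Qed.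

Lemma series_le_total_length (E : seq (V * V)) :
  connects E [set: V] ->
  \sum_(1 <= k <oo) term k <= (total_length E)%:E.
Proof.
move=> cE; pose S := sort >=%R [seq mdist e.1 e.2 | e <- E].
have S_sorted : sorted >=%R S by apply: sort_sorted => x y; exact: le_total.
have S_ge0 : all (>= 0)%R S.
  by apply/allP => x; rewrite mem_sort => /mapP[e _ ->]; exact: mdist_ge0.
(* The index k + 1 concerns k + 2 classes, crossed by at least k + 1 edges. At most k edges are
   longer than the entry of index k, so some crossing edge is not; past the end of [S] the default 0
   is the right bound. *)
have termS k : term k.+1 <= (nth 0%R S k)%:E.
  apply/term_le/le_gromov_hausdorff_simplex => [|p p_surj].
    have [kS|kS] := ltnP k (size S); last by rewrite nth_default.
    exact: (allP S_ge0) (mem_nth _ kS).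
  apply: contrapT => no_short.
  have := card_le_crossing cE p_surj; rewrite card_ord ltnS ltnNge => /negP; apply.
  apply: leq_trans (count_gt_nth k S_sorted).
  rewrite /S (permP (permEl (perm_sort _ _))) count_map.
  apply: sub_count => e /= ne; rewrite ltNge; apply/negP => short.
  by apply: no_short; exists e.1, e.2.
apply: lime_le; first by apply: is_cvg_nneseries => k _ _; exact: term_ge0.
apply: nearW => -[|m]; first by rewrite big_geq// lee_fin total_length_ge0.
rewrite big_add1/=.
apply: le_trans (_ : \sum_(0 <= k < m) (nth 0%R S k)%:E <= _).
  by apply: lee_sum => k _; exact: termS.
rewrite sumEFin lee_fin (le_trans (sum_nth_le _ S_ge0))//.
by rewrite /S (perm_big _ (permEl (perm_sort _ _))) big_map.
Qed.

End SpanningTree.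

(** * Minimal fillings and Steiner trees *)

(* MathComp-Analysis has another constant named adjacent. *)
Local Notation adjacent := Defs.adjacent.

Definition swap_edges (T : Type) (E : seq (T * T)) : seq (T * T) :=
  [seq (e.2, e.1) | e <- E].

Lemma mem_swap_edges (T : eqType) (E : seq (T * T)) (x y : T) :
  ((x, y) \in swap_edges E) = ((y, x) \in E).
Proof.
by apply/mapP/idP => [[[a b] ab [-> ->]]//|yx]; exists (y, x).
Qed.

Lemma total_length_swap (R : realType) (X : metricType R) (E : seq (X * X)) :
  total_length (swap_edges E) = total_length E.
Proof.
by rewrite /total_length big_map; apply: eq_bigr => e _; exact: metric_sym.
Qed.

Lemma total_length_cat (R : realType) (X : metricType R)
    (E F : seq (X * X)) :
  total_length (E ++ F) = (total_length E + total_length F)%R.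
Proof. by rewrite /total_length big_cat. Qed.

Lemma sum_uniq_sub (R : realType) (T : eqType) (s t : seq T) (f : T -> R) :
  (forall x, 0 <= f x)%R -> uniq s -> {subset s <= t} ->
  (\sum_(x <- s) f x <= \sum_(x <- t) f x)%R.
Proof.
move=> f0; elim: s t => [|a s IHs] t /=; first by rewrite big_nil sumr_ge0.
move=> /andP[nas us] st; have at_ : a \in t by rewrite st ?mem_head.
rewrite big_cons (perm_big _ (perm_to_rem at_)) big_cons lerD2l IHs// => x xs.
have : x \in a :: rem a t by rewrite -(perm_mem (perm_to_rem at_)) st// inE xs orbT.
by rewrite inE => /predU1P[xa|//]; rewrite -xa xs in nas.
Qed.

Section GraphLength.
Variables (R : realType) (X : metricType R) (G : graph X).

Lemma graph_length_le (E : seq (X * X)) :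
  (forall v w, adjacent G v w -> (v, w) \in E ++ swap_edges E) ->
  graph_length G <= (total_length E)%:E.
Proof.
move=> GE.
have -> : total_length E = (2^-1 * total_length (E ++ swap_edges E))%R.
  by rewrite total_length_cat total_length_swap; lra.
rewrite EFinM; apply: lee_wpmul2l; first by rewrite lee_fin invr_ge0.
apply: ge_ereal_sup => _ [A [finA AG] <-].
rewrite fsbig_finite//= sumEFin lee_fin.
apply: sum_uniq_sub => [e||[v w]]; [exact: mdist_ge0|exact: finmap.fset_uniq|].
by rewrite in_fset_set// inE => /AG; exact: GE.
Qed.

Lemma le_graph_length (E : seq (X * X)) :
  {in E, forall e, adjacent G e.1 e.2} -> uniq (E ++ swap_edges E) ->
  (total_length E)%:E <= graph_length G.
Proof.
move=> EG uE.
have -> : total_length E = (2^-1 * total_length (E ++ swap_edges E))%R.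
  by rewrite total_length_cat total_length_swap; lra.
rewrite EFinM; apply: lee_wpmul2l; first by rewrite lee_fin invr_ge0.
apply: esum_ge; exists [set` E ++ swap_edges E].
  split; first exact: finite_seq.
  move=> [v w] /=; rewrite mem_cat mem_swap_edges => /orP[/EG//|/EG /=].
  by rewrite adjacent_sym.
by rewrite -fsbig_seq// sumEFin.
Qed.

End GraphLength.

Lemma mf_le_total_length (R : realType) (M V : metricType R) (i : M -> V)
    (E : seq (V * V)) :
  distance_preserving i -> connects E [set: V] ->
  mf M <= (total_length E)%:E.
Proof.
move=> iE cE.
pose adj (v w : V) := (v != w) && ((v, w) \in E ++ swap_edges E).
have adjC : symmetric adj.
  move=> v w; rewrite /adj eq_sym !mem_cat !mem_swap_edges.
  by rewrite [X in _ && X]orbC.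
have adjI : irreflexive adj by move=> v; rewrite /adj eqxx.
have adjV v w : adj v w -> [set: V] v by [].
pose G : graph V := Graph adjC adjI adjV.
apply: ereal_inf_lbound; exists (total_length E) => //=.
exists V, i; split => //.
apply: le_trans (_ : graph_length G <= _); last first.
  by apply: graph_length_le => v w /andP[].
apply: ereal_inf_lbound; exists G => //; split => // v w _ _.
(* Reachability from [v] is constant along edges, so the cut form of connectivity yields paths. *)
pose q (x : V) := `[< exists2 s : seq V, path adj v s & last v s = x >].
have q_ext x y : (x, y) \in E ++ swap_edges E -> q x -> q y.
  move=> xy /asboolP[s vs sx]; apply/asboolP.
  have [<-|ne] := eqVneq x y; first by exists s.
  by exists (rcons s y); rewrite ?last_rcons// rcons_path vs sx /adj ne.
have qvw : q v = q w.
  apply: cE => // -[x y] xy; apply/idP/idP; apply: q_ext.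
    by rewrite mem_cat xy.
  by rewrite mem_cat mem_swap_edges xy orbT.
by apply/asboolP; rewrite -/(q w) -qvw; apply/asboolP; exists [::].
Qed.

(** * Finite trees and their reduction *)

Section Trees.
Variables (R : realType) (X : metricType R).

(** Acyclicity is expressed by the edge count: a connected graph with fewer edges than vertices is a
    tree. *)
Definition is_tree (W : seq X) (E : seq (X * X)) : Prop :=
  [/\ uniq W, {in E, forall e, e.1 \in W /\ e.2 \in W},
      connects E [set` W] & (size E < size W)%N].

(** The uniqueness clause excludes loops and edges repeated in either orientation, which allows
    comparison with [graph_length]; the last clause will bound the diameter of the space
    obtained. *)
Definition grown_in (G : graph X) (W : seq X) (E : seq (X * X)) : Prop :=
  [/\ is_tree W E, {in E, forall e, adjacent G e.1 e.2},
      uniq (E ++ swap_edges E) &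
      {in W &, forall x y, mdist x y <= total_length E}%R].

(** An edge of the path is added exactly when it reaches a new vertex, as a leaf; this keeps all the
    invariants. *)
Lemma grow_along_path (G : graph X) (s : seq X) (W : seq X) (E : seq (X * X))
    (x : X) :
  grown_in G W E -> x \in W -> path (adjacent G) x s ->
  exists W' E', [/\ grown_in G W' E', {subset W <= W'} & last x s \in W'].
Proof.
elim: s W E x => [|y s IHs] W E x gWE xW /=; first by exists W, E; split.
move=> /andP[xy ys]; have [yW|yW] := boolP (y \in W); first exact: IHs gWE yW ys.
have [[uW EW cE sE] EG uE dE] := gWE.
have [||W' [E' [g' sub' l']]] := IHs (y :: W) ((y, x) :: E) y _ _ ys; last 1 first.
- by exists W', E'; split => // z zW; apply: sub'; rewrite inE zW orbT.
- split.
  + split => /=; rewrite ?yW//.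
    * move=> e; rewrite inE => /predU1P[->|/EW[e1 e2]].
        by rewrite /= !inE eqxx xW orbT.
      by rewrite !inE e1 e2 !orbT.
    * move=> q qE; have qyx : q y = q x by apply: (qE (y, x)); rewrite mem_head.
      have qW z : z \in W -> q z = q x.
        move=> zW; apply: cE => // e eE.
        by apply: qE; rewrite inE eE orbT.
      have {}qW z : z \in y :: W -> q z = q x.
        by rewrite inE => /predU1P[->|/qW].
      by move=> z t /qW-> /qW->.
  + move=> e; rewrite inE => /predU1P[->/=|/EG//].
    by rewrite adjacent_sym.
  + have yxE : (y, x) \notin E by apply/negP => /EW[]; rewrite (negPf yW).
    have xyE : (x, y) \notin E by apply/negP => /EW[]; rewrite (negPf yW).
    have perm : perm_eq (((y, x) :: E) ++ swap_edges ((y, x) :: E))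
        ((y, x) :: (x, y) :: E ++ swap_edges E).
      by rewrite /= perm_cons (perm_catCA E [:: (x, y)]).
    rewrite (perm_uniq perm) /= uE andbT inE !mem_cat !mem_swap_edges.
    rewrite (negPf yxE) (negPf xyE) !orbF andbT.
    by apply: contraNN yW => /eqP[->].
  + have dy z : z \in W -> (mdist y z <= total_length ((y, x) :: E))%R.
      move=> zW; rewrite total_length_cons/=.
      by apply: le_trans (metric_triangle _ x _) _; rewrite lerD2l dE.
    move=> z t; rewrite !inE => /predU1P[->|zW] /predU1P[->|tW].
    * by rewrite mdistxx total_length_ge0.
    * exact: dy.
    * by rewrite metric_sym dy.
    * by rewrite total_length_cons (le_trans (dE _ _ zW tW))// lerDr mdist_ge0.
- by rewrite mem_head.
Qed.

Lemma grow_to_cover (G : graph X) (x0 : X) (A : seq X) :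
  connected_graph G -> vertices G x0 -> {in A, forall a, vertices G a} ->
  exists W E, [/\ grown_in G W E, x0 \in W & {subset A <= W}].
Proof.
move=> cG Gx0; elim: A => [|a A IHA] GA.
  exists [:: x0], [::]; split; rewrite ?mem_head//.
  split => //; first by split => // q _ x y /=; rewrite !inE => /eqP-> /eqP->.
  move=> x y; rewrite !inE => /eqP-> /eqP->.
  by rewrite mdistxx /total_length big_nil.
have [|W [E [gWE x0W AW]]] := IHA; first by move=> b bA; apply: GA; rewrite inE bA orbT.
have [s x0s <-] := cG x0 a Gx0 (GA a (mem_head _ _)).
have [W' [E' [g' WW' aW']]] := grow_along_path gWE x0W x0s.
exists W', E'; split => //; first exact: WW'.
by move=> b; rewrite inE => /predU1P[->//|/AW/WW'].
Qed.

Let incident (v : X) (e : X * X) := (e.1 == v) || (e.2 == v).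

Let other (v : X) (e : X * X) := if e.1 == v then e.2 else e.1.

Let mdist_other (v : X) (e : X * X) :
  incident v e -> mdist e.1 e.2 = mdist v (other v e).
Proof.
rewrite /incident /other; case: eqP => [->//|_] /= /eqP ->.
exact: metric_sym.
Qed.

(** Handshake count; only an inequality, since a loop counts once and an end outside [W] not at
    all. *)
Let sum_incident (W : seq X) (E : seq (X * X)) :
  uniq W -> (\sum_(v <- W) count (incident v) E <= 2 * size E)%N.
Proof.
move=> uW; elim: E => [|e E IHE] /=; first by rewrite big1.
rewrite big_split /= mulnS leq_add//.
apply: leq_trans (_ : \sum_(v <- W) ((e.1 == v) + (e.2 == v)) <= _)%N.
  by apply: leq_sum => v _; rewrite /incident; case: eqP; case: eqP.
have sum_eq x : (\sum_(v <- W) (x == v) <= 1)%N.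
  rewrite (eq_bigr (fun v => if v == x then 1 else 0)%N) => [|v _]; last first.
    by rewrite eq_sym; case: eqP.
  by rewrite -big_mkcond/= sum1_count count_uniq_mem ?leq_b1.
by rewrite big_split /= -(addn1 1) leq_add.
Qed.

Let incident_gt0 (W : seq X) (E : seq (X * X)) (v : X) :
  is_tree W E -> v \in W -> (1 < size W)%N -> (0 < count (incident v) E)%N.
Proof.
move=> [uW _ cE _] vW W2; rewrite lt0n; apply/eqP => c0.
have [w wW wv] : exists2 w, w \in W & w != v.
  apply/hasP; rewrite has_predC; apply/negP => /allP Wv.
  have : (size W <= size [:: v])%N.
    by apply: uniq_leq_size => // z /Wv; rewrite inE.
  by rewrite leqNgt W2.
suff : (v == v) = (w == v) by rewrite eqxx (negPf wv).
apply: (cE (fun z => z == v)) => // e eE.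
have : ~~ has (incident v) E by rewrite has_count c0.
by move=> /hasPn/(_ e eE); rewrite negb_or => /andP[/negPf-> /negPf->].
Qed.

(* A vertex of degree one is cut off; the two edges at a vertex of degree two *)
(* are replaced by the edge joining its neighbours.                           *)
Let remove_vertex (W : seq X) (E : seq (X * X)) (v : X) :
  is_tree W E -> v \in W -> (1 < size W)%N ->
  (count (incident v) E <= 2)%N ->
  exists2 E', is_tree (rem v W) E' & (total_length E' <= total_length E)%R.
Proof.
move=> tWE vW W2 deg_le2; have [uW EW cE sE] := tWE.
have deg_gt0 := incident_gt0 tWE vW W2.
have memW' z : (z \in rem v W) = (z != v) && (z \in W) by rewrite mem_rem_uniq ?inE.
pose E0 := [seq e <- E | ~~ incident v e].
have E0P e : e \in E0 -> [/\ e.1 != v, e.2 != v & e \in E].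
  by rewrite mem_filter negb_or => /andP[/andP[]].
have E0W e : e \in E0 -> e.1 \in rem v W /\ e.2 \in rem v W.
  by move=> /E0P[e1 e2 /EW[e1W e2W]]; rewrite !memW' e1 e2.
pose E1 := [seq e <- E | incident v e].
have sE01 : (size E1 + size E0 = size E)%N by rewrite !size_filter count_predC.
have lE : total_length E = (total_length E1 + total_length E0)%R.
  rewrite -total_length_cat /total_length; apply: perm_big.
  by rewrite perm_sym perm_filterC.
have E1P e : e \in E1 -> incident v e /\ other v e \in W.
  rewrite mem_filter => /andP[ve /EW[e1 e2]]; split => //.
  by rewrite /other; case: ifP.
have oE e (q : X -> bool) : incident v e -> q (other v e) = q v -> q e.1 = q e.2.
  by rewrite /incident /other; case: eqP => [->|_ /= /eqP->].
(* A colouring of the remaining vertices extends to [v] by the colour of [t]; the hypothesis makes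
   it constant on the edges at [v], and connectivity of the old tree applies. *)
have conn E' t : {subset E0 <= E'} ->
    (forall q : X -> bool, {in E', forall e, q e.1 = q e.2} ->
      {in E1, forall e, other v e != v -> q (other v e) = q t}) ->
    connects E' [set` rem v W].
  move=> E0E' ht q qE' x y /=; rewrite !memW' => /andP[xv xW] /andP[yv yW].
  pose q' z := if z == v then q t else q z.
  suff : q' x = q' y by rewrite /q' (negPf xv) (negPf yv).
  apply: cE => // e eE; have [ve|ve] := boolP (incident v e); last first.
    have e0 : e \in E0 by rewrite mem_filter ve.
    have [e1 e2 _] := E0P _ e0.
    by rewrite /q' (negPf e1) (negPf e2); apply/qE'/E0E'.
  apply: (oE _ q') => //; rewrite /q' eqxx; case: eqP => // /eqP ov.
  by apply: (ht q) => //; rewrite mem_filter ve.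
have sE1 : (0 < size E1 <= 2)%N by rewrite size_filter deg_gt0.
have tree E' :
    {in E', forall e, e.1 \in rem v W /\ e.2 \in rem v W} ->
    connects E' [set` rem v W] -> (size E' < size E)%N -> is_tree (rem v W) E'.
  move=> E'W cE' sE'; split => //; first exact: rem_uniq.
  by rewrite size_rem//; case: (size W) sE => // k; rewrite ltnS; exact: leq_trans.
case E1E : E1 sE1 => [|e [|f [|]]] // _.
- exists E0; last by rewrite lE lerDr total_length_ge0.
  apply: tree => //; last by rewrite -sE01 E1E.
  apply: (conn _ (other v e)) => // q _ g.
  by rewrite E1E inE => /eqP->.
- have [ve eW] : incident v e /\ other v e \in W by apply: E1P; rewrite E1E mem_head.
  have [vf fW] : incident v f /\ other v f \in W.
    by apply: E1P; rewrite E1E !inE eqxx orbT.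
  have [ev|ev] := eqVneq (other v e) v.
    exists E0; last by rewrite lE lerDr total_length_ge0.
    apply: tree => //; last by rewrite -sE01 E1E ltnS leqW.
    apply: (conn _ (other v f)) => // q _ g.
    by rewrite E1E !inE => /predU1P[->|/eqP->//]; rewrite ev eqxx.
  have [fv|fv] := eqVneq (other v f) v.
    exists E0; last by rewrite lE lerDr total_length_ge0.
    apply: tree => //; last by rewrite -sE01 E1E ltnS leqW.
    apply: (conn _ (other v e)) => // q _ g.
    by rewrite E1E !inE => /predU1P[->//|/eqP->]; rewrite fv eqxx.
  exists ((other v e, other v f) :: E0).
    have sub : {subset E0 <= (other v e, other v f) :: E0}.
      by move=> g gE; rewrite inE gE orbT.
    apply: tree => //; last by rewrite -sE01 E1E.
      move=> g; rewrite inE => /predU1P[->|/E0W//].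
      by rewrite /= !memW' ev fv.
    apply: (conn _ (other v e)) => // q qE g.
    rewrite E1E !inE => /predU1P[->//|/eqP-> _].
    by apply/esym/(qE (other v e, other v f)); rewrite mem_head.
  rewrite lE E1E !total_length_cons [total_length [::]]big_nil addr0 lerD2r.
  rewrite /= (mdist_other ve) (mdist_other vf).
  by rewrite (metric_sym v (other v e)) metric_triangle.
Qed.

(** With a = [size A], if all vertices outside [A] had degree at least 3, then 3|W| - 2a <= 2|E| <=
    2|W| - 2, whence |W| <= 2a - 2. So a larger tree has a removable vertex. *)
Lemma steiner_reduction (A W : seq X) (E : seq (X * X)) :
  uniq A -> (1 < size A)%N -> {subset A <= W} -> is_tree W E ->
  exists W' E', [/\ is_tree W' E', {subset A <= W'}, {subset W' <= W},
    (total_length E' <= total_length E)%R & (size W' <= 2 * size A - 2)%N].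
Proof.
move=> uA A2; have [m] := ubnP (size W); elim: m W E => // m IHm W E.
rewrite ltnS => Wm AW tWE; have [uW _ _ sE] := tWE.
have [small|big] := leqP (size W) (2 * size A - 2); first by exists W, E; split.
have W2 : (1 < size W)%N by apply: leq_trans A2 (uniq_leq_size uA AW).
have [v /andP[vA deg_v] vW] : exists2 v,
    (v \notin A) && (count (incident v) E <= 2)%N & v \in W.
  apply/exists2P/not_existsP => no_v.
  have : (\sum_(v <- W) (if v \in A then 1 else 3) <= 2 * size E)%N.
    apply: leq_trans (sum_incident E uW); rewrite big_seq [leqRHS]big_seq.
    apply: leq_sum => v vW; case: ifP => vA; first exact: incident_gt0 tWE vW W2.
    by rewrite ltnNge; apply/negP => deg; apply: (no_v v); rewrite vA deg.
  have -> : (\sum_(v <- W) (if v \in A then 1 else 3) =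
      3 * size W - 2 * count (mem A) W)%N.
    elim: (W) => [|a s IHs]; first by rewrite big_nil.
    rewrite big_cons IHs /=; have := count_size (mem A) s.
    by rewrite -topredE /=; case: (mem_seq A a) => /=; lia.
  have : (count (mem A) W <= size A)%N.
    rewrite -size_filter uniq_leq_size ?filter_uniq// => a.
    by rewrite mem_filter => /andP[].
  lia.
have [E' t' l'] := remove_vertex tWE vW W2 deg_v.
have [|||W1 [E1 [t1 AW1 W1W l1 s1]]] := IHm (rem v W) E' => //.
- by rewrite size_rem//; case: (size W) W2 Wm.
- by move=> a aA; rewrite mem_rem_uniq// inE AW// andbT; apply: contraNneq vA => <-.
- exists W1, E1; split => //; first by move=> z /W1W/mem_rem.
  exact: le_trans l1 l'.
Qed.

End Trees.

(** * Finite subspaces and the two inequalities *)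

Lemma enum_of_card (T : choiceType) (n : nat) :
  [set: T] #= `I_n -> exists s : seq T, [/\ uniq s, size s = n & forall x, x \in s].
Proof.
move=> cT; have /finite_seqP[s0 Ts0] : finite_set [set: T] by exists n.
have s_enum x : x \in undup s0.
  by rewrite mem_undup; have : [set: T] x by []; rewrite Ts0.
exists (undup s0); split => //; first exact: undup_uniq.
have /pcard_eqP/bijPex[f [fI f_inj f_surj]] := cT.
have f_inj' : injective f by move=> x y; apply: f_inj; rewrite inE.
rewrite -(size_map f) -[RHS](size_iota 0); apply/perm_size/uniq_perm.
- by rewrite map_inj_uniq ?undup_uniq.
- exact: iota_uniq.
- move=> i; rewrite mem_iota add0n leq0n /=; apply/mapP/idP => [[x _ ->]|i_n].
    exact: (fI x).
  by have [x _ <-] := f_surj i i_n; exists x.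
Qed.

Lemma subspace_of_tree (R : realType) (X : metricType R) (W : seq X)
    (E : seq (X * X)) (x0 : X) :
  is_tree W E -> x0 \in W ->
  exists (V : metricType R) (j : V -> X) (E' : seq (V * V)),
    [/\ distance_preserving j, forall x, (exists v, j v = x) <-> x \in W,
        [set: V] #<= `I_(size W), connects E' [set: V] &
        total_length E' = total_length E].
Proof.
move=> [uW EW cE _] x0W.
pose T := seq_sub W; pose dist (a b : T) := mdist (val a) (val b).
have [||||V [e [e_bij eE]]] := @metric_space_of R T dist.
- by move=> a; exact: mdistxx.
- by move=> a b /mdist_positivity/val_inj.
- by move=> a b; exact: metric_sym.
- by move=> a b c; exact: metric_triangle.
have [h eh he] := e_bij.
pose t0 : T := SeqSub x0W; pose ins x := e (insubd t0 x).
pose j v := val (h v).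
have jins x : x \in W -> j (ins x) = x by move=> xW; rewrite /j /ins eh insubdK.
have insj v : ins (j v) = v by rewrite /ins /j valKd he.
have jW v : j v \in W by exact: (valP (h v)).
have jE : distance_preserving j by move=> v w; rewrite -{2}(he v) -{2}(he w) eE.
exists V, j, [seq (ins e.1, ins e.2) | e <- E]; split => //.
- by move=> x; split => [[v <-]//|xW]; exists (ins x); exact: jins.
- suff /injfunPex[f] : exists2 f : V -> nat, set_fun [set: V] `I_(size W) f & set_inj [set: V] f.
    exact: inj_card_le.
  exists (fun v => index (j v) W) => [v _|v w _ _ vw].
    by rewrite /= index_mem.
  by rewrite -(insj v) -(insj w) -(nth_index x0 (jW v)) vw nth_index.
- move=> q qE v w _ _; rewrite -(insj v) -(insj w).
  apply: (cE (q \o ins)) => //= f fE.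
  by apply: (qE (ins f.1, ins f.2)); apply/mapP; exists f.
- rewrite /total_length big_map big_seq [RHS]big_seq; apply: eq_bigr => f fE.
  by have [f1 f2] := EW f fE; rewrite /= -jE !jins.
Qed.

(** The star centred at one point of M has n - 1 edges. *)
Lemma mf_le_diameter (R : realType) (M : metricType R) (n : nat) :
  [set: M] #= `I_n -> (0 < n)%N ->
  mf M <= (n%:R - 1)%:E * diameter M.
Proof.
move=> cardM n_gt0; have [[|m0 s] [us sn s_enum]] := enum_of_card cardM.
  by rewrite -sn in n_gt0.
apply: (@le_trans _ _ (total_length [seq (m0, x) | x <- s])%:E).
  apply: (@mf_le_total_length _ _ _ id) => // q qE.
  have q0 x : q x = q m0.
    have := s_enum x; rewrite inE => /predU1P[->//|xs].
    by apply/esym/(qE (m0, x))/mapP; exists x.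
  by move=> x y _ _; rewrite !q0.
rewrite -sn /= -natr1 addrK mule_natl /total_length big_map -sumEFin.
elim: (s) => [|x t IHt]; first by rewrite big_nil.
rewrite big_cons muleS leeD//; apply: ereal_sup_ubound.
by exists (m0, x).
Qed.

Theorem corollary5p1 (R : realType) (M : metricType R) (n : nat)
    (cardM : [set: M] #= `I_n) (n_ge2 : (2 <= n)%N) :
  (forall d : R, (n%:R - 1)%:E * diameter M < d%:E -> mf M < d%:E) /\
  (forall (d lambda : R)
      (mf_lt_d : mf M < d%:E) (le_2d_lambda : (2 * d <= lambda)%R),
    mf M = ereal_inf [set s : \bar R |
      exists V : metricType R, in_family M n d V /\
        s = \sum_(1 <= k <oo)
              (lambda%:E - 2%:E * gromov_hausdorff V
                 (simplex (scale_gt0 mf_lt_d le_2d_lambda) k.+1))]).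
Proof.
split=> [d|d lambda mf_lt_d le_2d_lambda].
  by apply: le_lt_trans; apply: mf_le_diameter cardM (ltnW n_ge2).
have [[|m0 ms'] [us sn s_enum]] := enum_of_card cardM; first by rewrite -sn in n_ge2.
set ms := m0 :: ms' in us sn s_enum.
have mdist_le (V : metricType R) (v w : V) : diameter V <= d%:E -> (mdist v w <= d)%R.
  rewrite -lee_fin; apply: le_trans; apply: ereal_sup_ubound.
  by exists (v, w).
apply/le_anti/andP; split.
  apply: le_ereal_inf_tmp => _ [V [[[i iE] cardV diamV] ->]].
  have /finite_seqP[s Vs] : finite_set [set: V].
    by apply/finite_set_leP; exists (2 * n - 2)%N.
  have [||E cE lE] := @exists_spanning_edges _ V s (i m0) d lambda
    (scale_gt0 mf_lt_d le_2d_lambda) _ _ le_2d_lambda.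
  - by move=> v; have : [set: V] v by []; rewrite Vs.
  - by move=> v w; exact: mdist_le.
  exact: le_trans (mf_le_total_length iE cE) lE.
set S := [set _ | _]; rewrite leNgt; apply/negP => mf_lt_S.
(* The minimum makes the graph shorter than both bounds: below d for the diameter of V, and below
   [ereal_inf S] for the contradiction. *)
have /ereal_inf_lt[_ [r [X [mu [muE smt_r]]] <-] r_lt] :
  mf M < mine (ereal_inf S) d%:E by rewrite lt_min mf_lt_S.
have /ereal_inf_lt[_ [G [cG GM] <-] G_lt] := le_lt_trans smt_r r_lt.
have mu_inj : injective mu.
  by move=> x y xy; apply/mdist_positivity; rewrite -muE xy mdistxx.
have [||W [E [[tWE EG uE dE] x0W msW]]] := @grow_to_cover _ _ G (mu m0) (map mu ms) cG.
- by apply: GM; exists m0.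
- by move=> _ /mapP[m _ ->]; apply: GM; exists m.
have E_lt := le_lt_trans (le_graph_length EG uE) G_lt.
have [||W' [E' [t' sub' W'W l' s']]] :=
  steiner_reduction (A := map mu ms) _ _ msW tWE.
- by rewrite map_inj_uniq.
- by rewrite size_map sn.
rewrite size_map sn in s'.
have x0W' : mu m0 \in W' by rewrite sub' ?map_f ?mem_head.
have [V [j [F [jE jW cardV cF lF]]]] := subspace_of_tree t' x0W'.
have diamV : diameter V <= d%:E.
  apply: ge_ereal_sup => _ [[v w] _ <-] /=; rewrite lee_fin -jE.
  (* The distance bound belongs to the unreduced tree and passes to [W'], whose vertices lie in
     [W]. *)
  apply: le_trans (dE _ _ _ _) _; try by apply/W'W/jW; eexists.
  by rewrite -lee_fin ltW// (lt_le_trans E_lt)// ge_min lexx orbT.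
have [v0 _] := (jW (mu m0)).2 x0W'.
have famV : in_family M n d V.
  split => //; last first.
    by apply: card_le_trans cardV _; rewrite card_le_II.
  have /choice[i iE] : forall m, exists v, j v = mu m.
    by move=> m; apply/jW/sub'/map_f.
  by exists i => x y; rewrite -jE !iE muE.
have : ereal_inf S <= (total_length E)%:E.
  apply: le_trans (_ : (total_length E')%:E <= _); last by rewrite lee_fin.
  rewrite -lF; apply: le_trans; last first.
    apply: (@series_le_total_length _ V v0 d lambda
      (scale_gt0 mf_lt_d le_2d_lambda) _ le_2d_lambda _ cF) => v w; exact: mdist_le.
  by apply: ereal_inf_lbound; exists V.
by apply/negP; rewrite -ltNge (lt_le_trans E_lt)// ge_min lexx.
Qed.
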